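(* For any real sequence $\lambda=(\lambda_{IJ})_{I,J\in\mathcal{D}}$ the following BMO condition holds: $$\sup_{I_0\in\mathcal{D}}\sup_{J_0\in\mathcal{D}}\Big(\frac{1}{|I_0||J_0|}\sum_{J\subset J_0}\lambda_{I_0J}^2\Big)^{1/2}\le\|\lambda\|_X.$$ The symmetric condition also holds: $$\sup_{I_0\in\mathcal{D}}\sup_{J_0\in\mathcal{D}}\Big(\frac{1}{|I_0||J_0|}\sum_{I\subset I_0}\lambda_{IJ_0}^2\Big)^{1/2}\le\|\lambda\|_X.$$
   Context: Functions are real-valued, and $\mathcal{D}$ is the standard dyadic grid in $\mathbb{R}$, i.e. the collection of intervals $[k2^{-i},(k+1)2^{-i})$, $i,k\in\mathbb{Z}$. Letters $I,J$ always denote elements of $\mathcal{D}$, and $\langle f\rangle_I=\frac1{|I|}\int_I f$. The norm $\|\lambda\|_X\in[0,\infty]$ is $$\|\lambda\|_X=\sup\Big|\sum_{I,J}\lambda_{IJ}\langle g_J\rangle_I\langle u_I\rangle_J\Big|,$$ where the supremum is over families $(g_J)_{J\in\mathcal{D}}$, $(u_I)_{I\in\mathcal{D}}$ of functions in $L^2(\mathbb{R})$ with $g_J\neq0$ for only finitely many $J$, $u_I\ne0$ for only finitely many $I$, and $\sum_J\|g_J\|_2^2=\sum_I\|u_I\|_2^2=1$. *)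

(* Defs.v *)
From HB Require Import structures.
From mathcomp Require Import all_boot all_order all_algebra.
From mathcomp Require Import all_classical all_reals all_analysis.

Set Implicit Arguments.
Unset Strict Implicit.
Unset Printing Implicit Defensive.
Import Order.TTheory GRing.Theory Num.Theory.
Import numFieldNormedType.Exports.

Local Open Scope classical_set_scope.
Local Open Scope ring_scope.

(* A set is used as a type through [set_type], so [I : dyadic R] is a dyadic
   interval, with underlying subset [dset I] of the line. *)
Definition dyadic (R : realType) : set (set R) :=
  [set I | exists i k : int,
    I = `[ (k%:~R : R) * 2 ^ (- i), ((k + 1)%:~R : R) * 2 ^ (- i) [%classic].

Arguments dyadic : clear implicits.

Definition dset (R : realType) (I : dyadic R) : set R := val I.

Definition dlen (R : realType) (I : dyadic R) : R :=
  fine (lebesgue_measure (dset I)).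

Definition avg (R : realType) (f : R -> R) (I : dyadic R) : R :=
  (dlen I)^-1 * Rintegral lebesgue_measure (dset I) f.

(* Elements of L^2 are represented by functions, so "nonzero" means "not almost
   everywhere zero". The sum of squared norms is an unconditional sum of
   nonnegative extended reals. *)
Definition unit_L2_family (R : realType) (g : dyadic R -> R -> R) : Prop :=
  [/\ forall J, g J \in Lfun (@lebesgue_measure R) 2%:E,
      finite_set [set J | ~ ae_eq (@lebesgue_measure R) setT (g J) (cst 0)] &
      (\esum_(J in [set: dyadic R])
         ('N[@lebesgue_measure R]_2%:E[EFin \o g J] ^+ 2) = 1)%E].

(* For unit families only finitely many terms are nonzero, so the finitely
   supported sum [\sum_(_ \in _)] is the actual double sum. *)
Definition bilin (R : realType) (lambda : dyadic R -> dyadic R -> R)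
    (g u : dyadic R -> R -> R) : R :=
  \sum_(p \in [set: dyadic R * dyadic R])
    (lambda p.1 p.2 * avg (g p.2) p.1 * avg (u p.1) p.2).

Definition Xnorm (R : realType) (lambda : dyadic R -> dyadic R -> R) : \bar R :=
  ereal_sup [set x | exists g u : dyadic R -> R -> R,
    [/\ unit_L2_family g, unit_L2_family u & x = `|bilin lambda g u|%:E]].

(* Main.v *)
Require Import Defs.
From HB Require Import structures.
From mathcomp Require Import all_boot all_order all_algebra.
From mathcomp Require Import all_classical all_reals all_analysis.
From mathcomp Require Import measurable_realfun.
Import Order.TTheory GRing.Theory Num.Theory.
Import numFieldNormedType.Exports.

(** Write [w_K] for the L^2-normalised indicator [1_K / |K|^(1/2)]. Fix [I0] and
    [J0], and test the bilinear form on
      [g_J = c_J w_(I0)],   [u_(I0) = w_(J0)],   [u_I = 0] for [I != I0],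
    where [c] is a finitely supported coefficient vector with [\sum_J c_J^2 = 1]
    that vanishes unless [J] is contained in [J0]. Both families have total
    squared norm [1]. Only the row [I = I0] survives, and there the averages are
    the constants [c_J / |I0|^(1/2)] and [1 / |J0|^(1/2)], the latter because [J]
    lies in [J0]. The form therefore equals
      [(|I0| |J0|)^(-1/2) \sum_J lambda_(I0 J) c_J]
    (lemma [Xnorm_ge_test]). By the equality case of Cauchy-Schwarz the best
    choice is [c] proportional to [lambda_(I0 .)], which turns the last sum into
    the l^2 norm of the row over a finite set of intervals [J]
    (lemma [finite_carleson_le_Xnorm]). The unconditional sum over all [J]
    contained in [J0] is the supremum of its finite subsums, so the bound passes
    to it (lemma [carleson_le_Xnorm]). The symmetric condition is the first one
    for the transposed sequence, since exchanging [g] and [u] shows that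
    transposition preserves the X-norm (lemma [Xnorm_transpose]). *)

Local Open Scope classical_set_scope.
Local Open Scope ring_scope.

Section DyadicTiles.
Variable R : realType.
Implicit Types (I J : dyadic R) (a b : R).

Lemma measurable_dset I : measurable (dset I).
Proof.
by rewrite /dset; have [i [k ->]] := set_valP I; exact: measurable_itv.
Qed.

Lemma dset_measureE I : lebesgue_measure (dset I) = (dlen I)%:E.
Proof.
rewrite /dlen /dset; have [i [k ->]] := set_valP I.
by rewrite lebesgue_measure_itv/=; case: ifP.
Qed.

Lemma dlen_gt0 I : 0 < dlen I.
Proof.
rewrite /dlen /dset; have [i [k ->]] := set_valP I.
have p : 0 < (2 : R) ^ (- i) by rewrite exprz_gt0.
rewrite lebesgue_measure_itv/= lte_fin ltr_pM2r// ltr_int ltzD1 lexx/=.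
by rewrite -mulrBl mulr_gt0// intrD addrAC subrr add0r.
Qed.

(** The coefficient [a] is kept inside so that [a] is, up to sign, the L^2 norm. *)
Definition tile I a (x : R) : R := a / Num.sqrt (dlen I) * \1_(dset I) x.

Lemma sqr_tile_Lnorm I a :
  ('N[@lebesgue_measure R]_2%:E[EFin \o tile I a] ^+ 2 = (a ^+ 2)%:E)%E.
Proof.
have n2 (x : \bar R) : (0 <= x -> x `^ 2%:R = x ^+ 2)%E.
  case: x => [r|_|//].
    by rewrite lee_fin poweR_EFin -EFin_expe => ?; rewrite powR_mulrn.
  by rewrite poweRyr ?pnatr_eq0// expe2 mulyy.
rewrite -n2; last exact: Lnorm_ge0.
rewrite poweR_Lnorm ?pnatr_eq0//.
have d0 := dlen_gt0 I.
under eq_integral => x _.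
  rewrite n2; last exact: abse_ge0.
  have -> : (`|(EFin \o tile I a) x| ^+ 2 =
     (a ^+ 2 / dlen I)%:E * (\1_(dset I) x)%:E)%E.
    rewrite -[(_ \o _) x]/((tile I a x)%:E) abse_EFin -EFin_expe -EFinM.
    congr EFin.
    rewrite -[LHS]normrX ger0_norm ?sqr_ge0// /tile !exprMn exprVn.
    rewrite sqr_sqrtr ?ltW// indicE.
    by case: (x \in dset I); rewrite ?expr1n ?expr0n ?mulr1 ?mulr0.
  over.
rewrite /= ge0_integralZl//; last 2 first.
- apply/measurable_EFinP; apply: measurable_indic; exact: measurable_dset.
- by rewrite lee_fin divr_ge0 ?sqr_ge0// ltW.
rewrite integral_indic// ?setIT; last exact: measurable_dset.
rewrite [X in (_ * X)%E](_ : _ = (dlen I)%:E); last exact: dset_measureE.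
by rewrite -EFinM divfK// gt_eqF.
Qed.

Lemma tile_Lfun I a : tile I a \in Lfun (@lebesgue_measure R) 2%:E.
Proof.
rewrite inE; apply/andP; split.
  rewrite inE/=; apply: measurable_funM => //.
  by apply: measurable_indic; exact: measurable_dset.
rewrite inE/= /finite_norm ltey; apply/eqP => e.
by have := sqr_tile_Lnorm I a; rewrite e.
Qed.

Lemma tile0 I : tile I 0 = cst 0.
Proof. by apply/funext => x; rewrite /tile !mul0r. Qed.

Lemma avg_tile I J a :
  dset J `<=` dset I -> avg (tile I a) J = a / Num.sqrt (dlen I).
Proof.
move=> JI; rewrite /avg.
have -> : (\int[lebesgue_measure]_(x in dset J) tile I a x)%R =
    (\int[lebesgue_measure]_(x in dset J) (a / Num.sqrt (dlen I)))%R.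
  apply: eq_Rintegral => x xJ; rewrite /tile indicE mem_set ?mulr1//.
  exact/JI/set_mem.
rewrite Rintegral_cst; last exact: measurable_dset.
by rewrite -/(dlen J) mulrC mulfK// gt_eqF// dlen_gt0.
Qed.

(** The normalisation in the definition of the norm constrains only the
    coefficients: the interval [K J] carrying the [J]-th function is arbitrary. *)
Lemma tile_unit_L2_family (K : dyadic R -> dyadic R) (c : dyadic R -> R)
    (F : set (dyadic R)) :
  finite_set F -> (forall J, ~ F J -> c J = 0) -> \sum_(J \in F) c J ^+ 2 = 1 ->
  unit_L2_family (fun J => tile (K J) (c J)).
Proof.
move=> finF cF c1; split=> [J||].
- exact: tile_Lfun.
- apply: sub_finite_set finF => J /= nJ; apply: contrapT => /cF c0.
  by apply: nJ; rewrite c0 tile0; exact: ae_eq_refl.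
- under eq_esum => J _ do rewrite sqr_tile_Lnorm.
  have <- : \esum_(J in F) (c J ^+ 2)%:E =
      (\esum_(J in [set: dyadic R]) (c J ^+ 2)%:E)%E.
    rewrite esum_mkcond; apply: eq_esum => J _; case: ifPn => //.
    by rewrite notin_setE => /cF ->; rewrite expr0n.
  rewrite esum_fset//; first by rewrite fsumEFin// c1.
  by move=> J _; rewrite lee_fin sqr_ge0.
Qed.

(** The test families supported on the single row [I0]: every [g_J] lives on
    [I0], and [u_(I0)], the only nonzero [u_I], lives on [J0]. *)
Lemma Xnorm_ge_test (lambda : dyadic R -> dyadic R -> R) I0 J0
    (F : set (dyadic R)) (c : dyadic R -> R) :
  finite_set F -> F `<=` [set J | dset J `<=` dset J0] ->
  (forall J, ~ F J -> c J = 0) -> \sum_(J \in F) c J ^+ 2 = 1 ->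
  (((\sum_(J \in F) lambda I0 J * c J) / Num.sqrt (dlen I0 * dlen J0))%:E
    <= Xnorm lambda)%E.
Proof.
move=> finF FJ0 cF c1.
pose g J := tile I0 (c J); pose u I := tile J0 (if I == I0 then 1 else 0).
have gU : unit_L2_family g by exact: (@tile_unit_L2_family (fun=> I0) c F).
have uU : unit_L2_family u.
  apply: (@tile_unit_L2_family (fun=> J0) (fun I => if I == I0 then 1 else 0)
    [set I0]) => //; first by move=> I /eqP/negbTE ->.
  by rewrite fsbig_set1 eqxx expr1n.
apply: (@le_trans _ _ `|bilin lambda g u|%:E); last first.
  by apply: ereal_sup_ubound; exists g, u.
rewrite lee_fin; apply: le_trans (ler_norm _).
rewrite le_eqVlt; apply/orP; left; apply/eqP.
(* Off the row [I0] the function [u_I] is zero, and on it [g_J] is zero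
   outside [F]. *)
rewrite /bilin -(fsbig_widen (pair I0 @` F))//; last first.
  move=> [I J] [_ /= nF].
  have [II0|nI] := eqVneq I I0; last first.
    by rewrite /u (negbTE nI) tile0 /avg Rintegral_cst ?mul0r ?mulr0//;
      exact: measurable_dset.
  rewrite /g cF ?tile0 /avg ?Rintegral_cst ?mul0r ?mulr0 ?mul0r//.
  - exact: measurable_dset.
  - by move=> FJ; apply: nF; exists J => //; rewrite II0.
rewrite fsbig_image; last by move=> J J' _ _ [].
rewrite mulr_fsuml; apply: eq_fsbigr => J /set_mem /FJ0 JJ0 /=.
rewrite /g /u eqxx !avg_tile// sqrtrM ?ltW ?dlen_gt0// invfM.
by rewrite div1r !mulrA.
Qed.

(** The supremum runs over a nonempty set: any dyadic interval carries a unit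
    family. *)
Lemma Xnorm_ge0 (lambda : dyadic R -> dyadic R -> R) I0 :
  (0 <= Xnorm lambda)%E.
Proof.
pose c J : R := if J == I0 then 1 else 0.
have U : unit_L2_family (fun J => tile J (c J)).
  apply: (@tile_unit_L2_family id c [set I0]) => //.
    by move=> I /eqP/negbTE; rewrite /c => ->.
  by rewrite fsbig_set1 /c eqxx expr1n.
set f := fun J => _ in U.
apply: (@le_trans _ _ `|bilin lambda f f|%:E); first by rewrite lee_fin.
by apply: ereal_sup_ubound; exists f, f.
Qed.

Lemma finite_carleson_le_Xnorm (lambda : dyadic R -> dyadic R -> R) I0 J0
    (F : set (dyadic R)) :
  finite_set F -> F `<=` [set J | dset J `<=` dset J0] ->
  ((Num.sqrt ((\sum_(J \in F) lambda I0 J ^+ 2) / (dlen I0 * dlen J0)))%:E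
    <= Xnorm lambda)%E.
Proof.
move=> finF FJ0; set S := \sum_(J \in F) _.
have S0 : 0 <= S by apply: fsumr_ge0 => J _; exact: sqr_ge0.
(* The extremal coefficients do not exist when the row vanishes on [F]. *)
have [->|Sn0] := eqVneq S 0.
  by rewrite mul0r sqrtr0; exact: Xnorm_ge0.
have Sgt0 : 0 < S by rewrite lt_neqAle eq_sym Sn0.
pose c J := if J \in F then lambda I0 J / Num.sqrt S else 0.
have := @Xnorm_ge_test lambda I0 J0 F c finF FJ0.
have -> : \sum_(J \in F) c J ^+ 2 = 1.
  rewrite -[RHS](divff Sn0) /S mulr_fsuml; apply: eq_fsbigr => J JF.
  by rewrite /c JF exprMn exprVn sqr_sqrtr.
have -> : \sum_(J \in F) lambda I0 J * c J = Num.sqrt S.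
  rewrite -[RHS](mulfK (_ : Num.sqrt S != 0)) ?gt_eqF ?sqrtr_gt0//.
  rewrite -expr2 sqr_sqrtr// [in RHS]/S mulr_fsuml; apply: eq_fsbigr => J JF.
  by rewrite /c JF expr2 mulrA.
rewrite -sqrtrV; last by rewrite ltW ?mulr_gt0 ?dlen_gt0.
rewrite -sqrtrM//; apply=> //.
by move=> J; rewrite /c => nF; rewrite memNset.
Qed.

Lemma carleson_le_Xnorm (lambda : dyadic R -> dyadic R -> R) I0 J0 :
  (sqrte (((dlen I0 * dlen J0)^-1)%:E *
     \esum_(J in [set J : dyadic R | dset J `<=` dset J0])
        (lambda I0 J ^+ 2)%:E) <= Xnorm lambda)%E.
Proof.
have X0 := Xnorm_ge0 lambda I0.
have d0 : 0 < dlen I0 * dlen J0 by rewrite mulr_gt0 ?dlen_gt0.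
rewrite -[leRHS]gee0_abs// -sqrte_sqr lee_sqrt ?sqre_ge0// lee_pdivrMl//.
(* Squaring both sides lets the supremum over finite [F] come out of the
   square root. *)
apply: ge_ereal_sup => _ [F [finF FJ0] <-].
rewrite -lee_pdivrMl// -lee_sqrt ?sqre_ge0// sqrte_sqr gee0_abs//.
rewrite fsumEFin// -EFinM mulrC.
exact: finite_carleson_le_Xnorm.
Qed.

Lemma bilin_transpose (lambda : dyadic R -> dyadic R -> R)
    (g u : dyadic R -> R -> R) :
  bilin (fun I J => lambda J I) g u = bilin lambda u g.
Proof.
rewrite /bilin (reindex_fsbigT (fun p => (p.2, p.1))) /=; last first.
  by exists (fun p => (p.2, p.1)) => -[].
by apply: eq_fsbigr => p _; rewrite mulrAC.
Qed.

Lemma Xnorm_transpose (lambda : dyadic R -> dyadic R -> R) :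
  Xnorm (fun I J => lambda J I) = Xnorm lambda.
Proof.
rewrite /Xnorm; congr ereal_sup; apply/seteqP; split => _ [g [u [gU uU ->]]];
  by exists u, g; rewrite bilin_transpose.
Qed.

End DyadicTiles.

Theorem proposition4p4 (R : realType) (lambda : dyadic R -> dyadic R -> R) :
  (ereal_sup (range (fun I0 : dyadic R =>
     ereal_sup (range (fun J0 : dyadic R =>
       sqrte (((dlen I0 * dlen J0)^-1)%:E *
         \esum_(J in [set J : dyadic R | dset J `<=` dset J0])
            (lambda I0 J ^+ 2)%:E)))))
   <= Xnorm lambda)%E /\
  (ereal_sup (range (fun I0 : dyadic R =>
     ereal_sup (range (fun J0 : dyadic R =>
       sqrte (((dlen I0 * dlen J0)^-1)%:E *
         \esum_(I in [set I : dyadic R | dset I `<=` dset I0])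
            (lambda I J0 ^+ 2)%:E)))))
   <= Xnorm lambda)%E.
Proof.
split; apply: ge_ereal_sup => _ [I0 _ <-]; apply: ge_ereal_sup => _ [J0 _ <-].
  exact: carleson_le_Xnorm.
rewrite -Xnorm_transpose mulrC.
exact: (carleson_le_Xnorm _ (fun I J => lambda J I)).
Qed.
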